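(* Let $L$ be a (left) Leibniz algebra over a field $\mathbb{F}$ of characteristic zero which is complete in the following sense: $\mathrm{Z}(L)=0$ and all derivations of $L$ are inner. Let $f\colon L\times L\to L$ be a bilinear map. Then $f$ is a biderivation of $L$ if and only if there exist linear maps $\varphi,\psi\colon L\to L$ such that, for all $x,y\in L$, $$f(x,y)=[\varphi(x),y]=[\psi(y),x].$$
   Context: A (left) Leibniz algebra over a field $\mathbb{F}$ is an $\mathbb{F}$-vector space $L$ with an $\mathbb{F}$-bilinear map $[-,-]\colon L\times L\to L$ satisfying $[x,[y,z]]=[y,[x,z]]+[[x,y],z]$ for all $x,y,z\in L$. The center is $\mathrm{Z}(L)=\{x\in L\mid [x,y]=[y,x]=0 \text{ for all } y\in L\}$. A derivation of $L$ is a linear map $D\colon L\to L$ with $D([x,y])=[D(x),y]+[x,D(y)]$ for all $x,y\in L$. A derivation is inner if it equals a left multiplication $L_x\colon y\mapsto [x,y]$ for some $x\in L$. A biderivation of $L$ is an $\mathbb{F}$-bilinear map $f\colon L\times L\to L$ such that $f(x,-)$ and $f(-,x)$ are derivations of $L$ for all $x\in L$. *)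

(* Defs.v *)
From mathcomp Require Import all_boot all_algebra.

Set Implicit Arguments.
Unset Strict Implicit.
Unset Printing Implicit Defensive.

Import GRing.Theory.
Local Open Scope ring_scope.

Section LeibnizAlgebra.

Variables (F : fieldType) (L : lmodType F) (br : {bilinear L -> L -> L}).

Local Notation "[[ x , y ]]" := (br x y) (x at level 200, y at level 200).

Definition left_leibniz : Prop :=
  forall x y z : L, [[x, [[y, z]]]] = [[y, [[x, z]]]] + [[[[x, y]], z]].

Definition in_center (x : L) : Prop :=
  forall y : L, [[x, y]] = 0 /\ [[y, x]] = 0.

Definition derivation (D : L -> L) : Prop :=
  linear D /\ forall x y : L, D [[x, y]] = [[D x, y]] + [[x, D y]].

Definition inner (D : L -> L) : Prop :=
  exists x : L, forall y : L, D y = [[x, y]].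

(* The inclusion of 0 in the center is automatic by bilinearity. *)
Definition complete : Prop :=
  (forall x : L, in_center x -> x = 0) /\
  (forall D : L -> L, derivation D -> inner D).

Definition biderivation (f : {bilinear L -> L -> L}) : Prop :=
  forall x : L, derivation (f x) /\ derivation (f^~ x).

End LeibnizAlgebra.

(* Main.v *)
Require Import Defs.
From HB Require Import structures.
From mathcomp Require Import all_boot all_algebra boolp classical_sets.

Import GRing.Theory.
Local Open Scope ring_scope.

(* Completeness gives, for each [x], some [a] with [f x = br a], but [br] need
   not be injective (the center being zero does not exclude that [br a = 0] for
   some nonzero [a]), so a linear choice of [a] has to be extracted from the
   subspace of all such pairs [(x, a)]; the same argument applies to [f^~ y]. *)

(* Zorn's lemma on the graphs of linear partial functions contained in [R];
   a maximal one is total, since it extends linearly to any point outside its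
   domain. *)
Lemma linear_selection (F : fieldType) (V W : lmodType F)
    (R : set (V * W)) (R0 : R 0)
    (Rlin : forall (k : F) (u v : V * W), R u -> R v -> R (k *: u + v))
    (Rtot : forall x, exists w, R (x, w)) :
  exists phi : {linear V -> W}, forall x, R (x, phi x).
Proof.
pose lin (G : set (V * W)) := forall (k : F) u v, G u -> G v -> G (k *: u + v).
(* By linearity, two values over one point differ by a value over [0], so the last clause makes [G]
   single-valued. *)
pose P (G : set (V * W)) :=
  [/\ forall u, G u -> R u, lin G & forall w, G (0, w) -> w = 0].
have [A AP Atot|G [[GR Glin Gfun] Gmax]] := @Zorn_bigcup _ P.
  split=> [u [X /AP[XR _ _]] /XR //|k u v [X AX Xu] [Y AY Yv]|w [X /AP[_ _ Xfun]]].
    have [XY|YX] := Atot _ _ AX AY.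
      by exists Y => //; have [_ Ylin _] := AP _ AY; apply: Ylin => //; exact: XY.
    by exists X => //; have [_ Xlin _] := AP _ AX; apply: Xlin => //; exact: YX.
  exact: Xfun.
(* [P] also admits the empty set. A linear [G] missing [0] is empty, hence strictly inside the graph
   [{0}]. *)
have G0 : G 0.
  apply: contrapT => nG0; apply: (Gmax (fun u => u = 0)).
    split=> [u Gu|sG]; last exact/nG0/sG.
    case: nG0; rewrite -(addNr u) -scaleN1r; exact: Glin.
  split=> [u -> //|k u v -> ->|w [] //].
  by rewrite scaler0 addr0.
have GZ k u : G u -> G (k *: u) by move=> Gu; rewrite -[_ *: _]addr0; exact: Glin.
have GB u v : G u -> G v -> G (u - v).
  by move=> Gu Gv; rewrite addrC -scaleN1r; exact: Glin.
have Gtot x : exists w, G (x, w).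
  apply: contrapT => nGx; have [a Ra] := Rtot x.
  (* [H] is [G] plus the line spanned by [(x, a)]. *)
  pose H (u : V * W) := exists k : F, G (u - k *: (x, a)).
  apply: (Gmax H); first split=> [u Gu|HG].
  - by exists 0; rewrite scale0r subr0.
  - by apply: nGx; exists a; apply: HG; exists 1; rewrite scale1r subrr.
  split=> [u [k /GR Ru]|k u v [l Gu] [m Gv]|w [k]].
  - by rewrite -(subrK (k *: (x, a)) u) addrC; exact: Rlin.
  - exists (k * l + m); have := Glin k _ _ Gu Gv.
    by rewrite scalerBr scalerA addrACA -opprD -scalerDl.
  have [->|k0] := eqVneq k 0; first by rewrite scale0r subr0; exact: Gfun.
  (* Here [(- k *: x, w - k *: a)] lies in [G]; dividing by [- k] puts [x] in the domain of [G]. *)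
  move=> /(GZ (- k^-1)) Gx; case: nGx; exists (- k^-1 *: (w - k *: a)).
  by move: Gx; congr G; congr pair; rewrite /= sub0r scaleNr scalerN opprK scalerK.
have [phi Gphi] := choice Gtot.
have phi_lin : linear phi.
  move=> k u v; apply/eqP; rewrite -subr_eq0; apply/eqP/Gfun.
  by have := GB _ _ (Gphi (k *: u + v)) (Glin k _ _ (Gphi u) (Gphi v));
    congr G; congr pair; rewrite /= subrr.
pose phiM := GRing.isLinear.Build F V W *:%R phi phi_lin.
pose phiL : {linear V -> W} := HB.pack phi phiM.
by exists phiL => x; exact/GR/Gphi.
Qed.

Section Biderivations.

Variables (F : fieldType) (L : lmodType F) (br : {bilinear L -> L -> L}).

Lemma derivation_left_mul (leibL : left_leibniz br) (x : L) :
  derivation br (br x).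
Proof. by split=> [k u v|y z]; [rewrite linearPr | rewrite leibL addrC]. Qed.

(** The pairs [(x, a)] with [g x] equal to [br a] pointwise form a subspace, by linearity in the
    first argument; innerness gives every [x] a partner. *)
Lemma linear_inner_selection (g : L -> L -> L)
    (g_lin : forall y, linear (g^~ y)) (g_inner : forall x, inner br (g x)) :
  exists phi : {linear L -> L}, forall x y, g x y = br (phi x) y.
Proof.
have g0 y : g 0 y = 0.
  by have := g_lin y (-1) 0 0; rewrite !scaleN1r !addNr.
apply: (@linear_selection _ _ _ (fun u => forall y, g u.1 y = br u.2 y)) => //.
- by move=> y; rewrite g0 linear0l.
- by move=> k u v gu gv y; rewrite /= g_lin gu gv linearPl.
Qed.

End Biderivations.

Theorem theorem3p2 (F : fieldType) (charF0 : [pchar F] =i pred0)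
    (L : lmodType F) (br : {bilinear L -> L -> L})
    (leibL : left_leibniz br) (complL : complete br)
    (f : {bilinear L -> L -> L}) :
  biderivation br f <->
  exists phi psi : {linear L -> L},
    forall x y : L, f x y = br (phi x) y /\ f x y = br (psi y) x.
Proof.
split=> [fD|[phi [psi fE]] x].
  have [_ inn] := complL.
  have [phi phiE] : exists phi : {linear L -> L}, forall x y, f x y = br (phi x) y.
    apply: linear_inner_selection => [y|x]; first by case: (fD y) => _ [].
    by apply: inn; case: (fD x).
  have [psi psiE] : exists psi : {linear L -> L}, forall y x, f x y = br (psi y) x.
    apply: (@linear_inner_selection _ _ _ (fun y x => f x y)) => [x|y].
      by case: (fD x) => -[].
    by apply: inn; case: (fD y).
  by exists phi, psi => x y; split.
(* Both partial maps of [f] are left multiplications, which the left Leibniz identity makes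
   derivations. *)
have fl : f x = br (phi x) :> (L -> L) by apply/funext => y; exact: (fE x y).1.
have fr : f^~ x = br (psi x) :> (L -> L) by apply/funext => y; exact: (fE y x).2.
by rewrite fl fr; split; exact: derivation_left_mul.
Qed.
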